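(* For every positive integer $\alpha$, the approximation ratio of the greedy algorithm on the set of objective functions of instances of $\textsc{Multi-Sink }\alpha\textsc{-Commodity Flow}$ is at least $\alpha\frac{e^{\alpha}}{e^{\alpha}-1}$.
   Context: Let $G=(V,E)$ be a directed graph, $s\in V$, $T\subseteq V$, and $\mu\colon E\to\mathbb{R}_{\geq0}$. With $\delta^{+}(v)=(\{v\}\times V)\cap E$ and $\delta^{-}(v)=(V\times\{v\})\cap E$, the excess of $v$ under $\vartheta\colon E\to\mathbb{R}_{\geq0}$ is $\mathrm{ex}_{\vartheta}(v)=\sum_{e\in\delta^{-}(v)}\vartheta(e)-\sum_{e\in\delta^{+}(v)}\vartheta(e)$. An $s$-$T$-flow w.r.t. $\mu$ is $\vartheta\colon E\to\mathbb{R}_{\geq0}$ with $\vartheta(e)\leq\mu(e)$ for all $e$, $\mathrm{ex}_\vartheta(v)=0$ for all $v\in V\setminus(\{s\}\cup T)$, and $\mathrm{ex}_\vartheta(t)\geq0$ for all $t\in T$. For a positive integer $\alpha$ and capacities $\vec\mu=(\mu_1,\dots,\mu_\alpha)$, a multicommodity-flow is $\vec\vartheta=(\vartheta_1,\dots,\vartheta_\alpha)$ with each $\vartheta_i$ an $s$-$T$-flow w.r.t. $\mu_i$; $\mathrm{minex}_{\vec\vartheta}(t)=\min_{i}\mathrm{ex}_{\vartheta_i}(t)$ and $\mathrm{minex}_{\vec\vartheta}(T')=\sum_{t\in T'}\mathrm{minex}_{\vec\vartheta}(t)$. An instance of $\textsc{Multi-Sink }\alpha\textsc{-Commodity Flow}$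 is $(G,s,T,\vec\mu)$ with objective $f\colon2^T\to\mathbb{R}_{\geq0}$, $f(X)=\max_{\vec\vartheta}\mathrm{minex}_{\vec\vartheta}(X)$ over all multicommodity-flows. For a set function $f$ on a finite ground set $U$: $S^{*}_{k}\in\arg\max_{X\subseteq U,|X|\leq k}f(X)$; the greedy algorithm picks $x_i\in\arg\max_{x\in U\setminus\{x_1,\dots,x_{i-1}\}} f(\{x_1,\dots,x_{i-1}\}\cup\{x\})$ (ties broken by an arbitrary rule) and $S^{G}_k=\{x_1,\dots,x_k\}$. The approximation ratio on a class $\mathcal{F}$ is $\sup\max_{k\in\{1,\dots,|U|\}} f(S^{*}_{k})/f(S^{G}_{k})$, the supremum taken over $f\in\mathcal{F}$ and all greedy runs (tie-breaking rules). *)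

(* Defs.v *)
From HB Require Import structures.
From mathcomp Require Import all_boot all_order all_algebra.
From mathcomp Require Import all_classical all_reals all_analysis.

Set Implicit Arguments.
Unset Strict Implicit.
Unset Printing Implicit Defensive.

Import Order.TTheory GRing.Theory Num.Theory.
Local Open Scope ring_scope.

Section Greedy.
Variable R : realType.

Section SetFunction.
(* The ground set is U : {set W}; f is only ever evaluated on subsets of U. *)
Variables (W : finType) (U : {set W}) (f : {set W} -> R).

Definition optimal_set (k : nat) : {set W} :=
  [arg max_(X > finset.set0 | (X \subset U) && (#|X| <= k)%N) f X]%O.

(* x i is the element picked in step i + 1. *)
Definition picked (x : 'I_#|U| -> W) (k : nat) : {set W} :=
  [set x j | j : 'I_#|U| & (j < k)%N]%SET.

Definition greedy_run (x : 'I_#|U| -> W) : Prop :=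
  forall i : 'I_#|U|,
    x i \in U :\: picked x i /\
    forall y, y \in U :\: picked x i ->
      f (y |: picked x i) <= f (x i |: picked x i).

(* Division in \bar R: a / 0 = +oo for a > 0, and 0 / 0 = 0. *)
Definition run_ratio (x : 'I_#|U| -> W) : \bar R :=
  (\big[maxe/-oo]_(1 <= k < #|U|.+1)
     ((f (optimal_set k))%:E / (f (picked x k))%:E))%E.

End SetFunction.

Definition setfun_class := forall W : finType, {set W} -> ({set W} -> R) -> Prop.

Definition approximation_ratio (F : setfun_class) : \bar R :=
  ereal_sup [set r | exists (W : finType) (U : {set W}) (f : {set W} -> R)
                            (x : 'I_#|U| -> W),
               [/\ F W U f, greedy_run f x & r = run_ratio f x]]%classic.

End Greedy.

Section Flow.
Variables (R : realType) (V : finType) (E : {set V * V}) (s : V) (T : {set V}).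

(* Functions on the edge set E are total functions on V * V whose values
   outside E are irrelevant. *)

Definition out_edges (v : V) : {set V * V} := finset.setX [set v]%SET [set: V]%SET :&: E.
Definition in_edges (v : V) : {set V * V} := finset.setX [set: V]%SET [set v]%SET :&: E.

Definition excess (theta : V * V -> R) (v : V) : R :=
  \sum_(e in in_edges v) theta e - \sum_(e in out_edges v) theta e.

Definition is_flow (mu theta : V * V -> R) : Prop :=
  [/\ forall e, e \in E -> 0 <= theta e <= mu e,
      forall v, v \notin s |: T -> excess theta v = 0
    & forall t, t \in T -> 0 <= excess theta t].

(* The number of commodities is n.+1. *)
Variable n : nat.

Definition is_multiflow (mu theta : 'I_n.+1 -> V * V -> R) : Prop :=
  forall i, is_flow (mu i) (theta i).

Definition minex (theta : 'I_n.+1 -> V * V -> R) (t : V) : R :=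
  \big[Num.min/excess (theta ord0) t]_(i < n.+1) excess (theta i) t.

Definition minex_set (theta : 'I_n.+1 -> V * V -> R) (X : {set V}) : R :=
  \sum_(t in X) minex theta t.

Definition is_objective (mu : 'I_n.+1 -> V * V -> R) (f : {set V} -> R) : Prop :=
  forall X : {set V}, X \subset T ->
    let values := [set minex_set theta X | theta in is_multiflow mu]%classic in
    values (f X) /\ ubound values (f X).

End Flow.

Definition multi_sink_flow_objectives (R : realType) (n : nat) : setfun_class R :=
  fun (V : finType) (T : {set V}) (f : {set V} -> R) =>
    exists (E : {set V * V}) (s : V) (mu : 'I_n.+1 -> V * V -> R),
      (forall i e, e \in E -> 0 <= mu i e) /\ is_objective E s T mu f.

(* Main.v *)
Require Import Defs.
From HB Require Import structures.
From mathcomp Require Import all_boot all_order all_algebra.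
From mathcomp Require Import all_classical all_reals all_analysis.
From mathcomp Require Import ring.

Set Implicit Arguments.
Unset Strict Implicit.
Unset Printing Implicit Defensive.

Import Order.TTheory GRing.Theory Num.Theory.
Import numFieldNormedType.Exports.
Local Open Scope ring_scope.

(** Write a for the number of commodities, let k = a m and q = 1 - 1/m.  There are
    k "optimal" sinks, split into a blocks of size m and each fed by the source with
    capacity 1 in every commodity, and k "greedy" sinks g_0, ..., g_(k-1).  In
    commodity c, the sink g_l is fed only by the optimal sinks of block c, with
    capacity q^l / m from each of them.  Hence a unit of g_l costs a units of optimal
    sinks, taken from different blocks.

    The optimal sinks together have value k, while {g_0, ..., g_(i-1)} has value
    1 + q + ... + q^(i-1), and adding any sink raises this by at most q^i, which g_i
    attains.  So greedy may pick g_0, ..., g_(k-1), of value m (1 - q^k), and the ratio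
    is a / (1 - (1 - 1/m)^(a m)), which tends to a / (1 - e^(-a)). *)

(** * Continuity of finite sums and minima *)

Lemma continuous_sumr (R : realType) (X : topologicalType) (I : Type)
    (r : seq I) (P : pred I) (h : I -> X -> R) :
  (forall i, continuous (h i)) ->
  continuous (fun x => \sum_(i <- r | P i) h i x).
Proof.
move=> hc x; apply: cvg_big => [|i _]; first exact: add_continuous.
exact: hc.
Qed.

Lemma continuous_bigminr (R : realType) (X : topologicalType) (I : Type)
    (r : seq I) (h0 : X -> R) (h : I -> X -> R) :
  continuous h0 -> (forall i, continuous (h i)) ->
  continuous (fun x => \big[Num.min/h0 x]_(i <- r) h i x).
Proof.
move=> h0c hc; elim: r => [|i r IHr].
  by under eq_fun do rewrite big_nil.
under eq_fun do rewrite big_cons.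
exact: (min_fun_continuous (hc i) IHr).
Qed.

(** * Attainment of the maximum that defines the objective, by compactness *)

Section ObjectiveExists.
Variables (R : realType) (V : finType) (E : {set V * V}) (s : V) (T : {set V}).

Lemma eq_excess (theta theta' : V * V -> R) :
  {in E, theta =1 theta'} -> excess E theta =1 excess E theta'.
Proof.
by move=> eqt v; congr (_ - _); apply: eq_bigr => e /setIP[_ /eqt].
Qed.

Lemma eq_is_flow (mu theta theta' : V * V -> R) :
  {in E, theta =1 theta'} -> is_flow E s T mu theta -> is_flow E s T mu theta'.
Proof.
move=> eqt [bnd csv snk]; split=> [e eE|v vT|t tT].
- by rewrite -eqt//; exact: bnd.
- by rewrite -(eq_excess eqt); exact: csv.
- by rewrite -(eq_excess eqt); exact: snk.
Qed.

Lemma is_flow0 (mu : V * V -> R) :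
  (forall e, e \in E -> 0 <= mu e) -> is_flow E s T mu (fun=> 0).
Proof.
have ex0 v : excess E (fun=> 0 : R) v = 0 by rewrite /excess !big1 ?subrr.
by move=> mu0; split=> [e eE|v _|t _]; rewrite ?ex0 ?lexx ?mu0.
Qed.

Variable n : nat.

Lemma minex_le (theta : 'I_n.+1 -> V * V -> R) (i : 'I_n.+1) (t : V) :
  minex E theta t <= excess E (theta i) t.
Proof. exact: bigmin_le. Qed.

Lemma le_minex (theta : 'I_n.+1 -> V * V -> R) (t : V) (a : R) :
  (forall i, a <= excess E (theta i) t) -> a <= minex E theta t.
Proof. by move=> le_a; apply: le_bigmin. Qed.

Lemma eq_minex_set (theta theta' : 'I_n.+1 -> V * V -> R) (X : {set V}) :
  (forall i, {in E, theta i =1 theta' i}) ->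
  minex_set E theta X = minex_set E theta' X.
Proof.
move=> eqt; apply: eq_bigr => t _; rewrite /minex (eq_excess (eqt _)).
by apply: eq_bigr => i _; exact: eq_excess.
Qed.

(** One real coordinate per commodity and vertex pair, so that Tychonoff's theorem applies. *)
Let space := prod_topology (fun _ : 'I_n.+1 * (V * V) => R : topologicalType).

Let excess_continuous (i : 'I_n.+1) (v : V) :
  continuous (fun g : space => excess E (fun e => g (i, e)) v).
Proof.
have coord e : continuous (fun g : space => g (i, e)).
  exact: (@proj_continuous _ (fun _ : 'I_n.+1 * (V * V) => R : topologicalType)).
move=> g; apply: (@continuousB _ R^o);
  exact: (@continuous_sumr R space (V * V)%type _ _ (fun e g => g (i, e))).
Qed.

Let minex_set_continuous (X : {set V}) :
  continuous (fun g : space => minex_set E (fun i e => g (i, e)) X).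
Proof.
apply: continuous_sumr => t; apply: continuous_bigminr => [|i];
  exact: excess_continuous.
Qed.

(** [is_objective] demands that each maximum be attained. Multicommodity-flows are cut out of a
    compact box by closed conditions, and [minex_set] is continuous. *)
Lemma objective_exists (mu : 'I_n.+1 -> V * V -> R) :
  (forall i e, e \in E -> 0 <= mu i e) ->
  exists f : {set V} -> R, is_objective E s T mu f.
Proof.
move=> mu0.
suff /choice[f fP] : forall X : {set V}, exists y : R,
    [set minex_set E theta X | theta in is_multiflow E s T mu]%classic y /\
    ubound [set minex_set E theta X | theta in is_multiflow E s T mu]%classic y.
  by exists f => X _; exact: fP.
move=> X.
(* Coordinates off [E] are pinned to 0; left free, they would destroy compactness. *)
pose box (j : 'I_n.+1 * (V * V)) : set R :=
  if j.2 \in E then `[0, mu j.1 j.2]%classic else [set 0]%classic.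
pose K : set space := ([set g | forall j, box j (g j)] `&`
  (\bigcap_(j in [set j : 'I_n.+1 * V | j.2 \notin s |: T])
     [set g : space | excess E (fun e => g (j.1, e)) j.2 = 0] `&`
   \bigcap_(j in [set j : 'I_n.+1 * V | j.2 \in T])
     [set g : space | 0 <= excess E (fun e => g (j.1, e)) j.2]))%classic.
have Kcompact : compact K.
  apply: compact_closedI.
    apply: (@tychonoff _ (fun _ => R : topologicalType)) => j.
    by rewrite /box; case: ifP => _; [exact: segment_compact|exact: compact_set1].
  apply: closedI; apply: closed_bigI => -[i v] _ /=.
  - apply: (@preimage_closed _ _ (fun g : space => excess E (fun e => g (i, e)) v)
      [set 0]%classic); first by move=> g _; exact: excess_continuous.
    exact: closed_eq.
  - apply: (@preimage_closed _ _ (fun g : space => excess E (fun e => g (i, e)) v)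
      [set x | 0 <= x]%classic); first by move=> g _; exact: excess_continuous.
    exact: closed_ge.
have KP (g : space) : K g -> is_multiflow E s T mu (fun i e => g (i, e)).
  move=> [Kbox [Kcsv Ksnk]] i; split=> [e eE|v vT|t tT].
  - by have := Kbox (i, e); rewrite /box /= eE /= in_itv.
  - exact: (Kcsv (i, v)).
  - exact: (Ksnk (i, t)).
(* Resetting a flow to 0 off [E] brings it into [K]; excesses do not change. *)
have PK theta : is_multiflow E s T mu theta ->
    K (fun j => if j.2 \in E then theta j.1 j.2 else 0).
  move=> flow.
  have eqt i : {in E, theta i =1 fun e => if e \in E then theta i e else 0}.
    by move=> e ->.
  split=> [[i e]|]; first rewrite /box /=.
    case: ifP => // eE; have [bnd _ _] := flow i.
    by rewrite /= in_itv; exact: bnd.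
  by split=> -[i v] /= vT; have [_ csv snk] := eq_is_flow (eqt i) (flow i);
    [exact: csv|exact: snk].
have [||g Kg gmax] := @compact_EVT_max _ R
    (fun g : space => minex_set E (fun i e => g (i, e)) X) K _ Kcompact.
- by exists (fun j => if j.2 \in E then 0 else 0); apply: (PK (fun _ _ => 0)) => i;
    apply: is_flow0; exact: mu0.
- exact/continuous_subspaceT/minex_set_continuous.
exists (minex_set E (fun i e => g (i, e)) X); split.
  by exists (fun i e => g (i, e)) => //; apply: KP; rewrite inE in Kg.
move=> _ [theta flow <-].
have -> : minex_set E theta X =
    minex_set E (fun i e => if e \in E then theta i e else 0) X.
  by apply: eq_minex_set => i e ->.
apply: (gmax (fun j => if j.2 \in E then theta j.1 j.2 else 0)).
by rewrite inE; exact: PK.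
Qed.

End ObjectiveExists.

(** * Greedy runs with prescribed first picks *)

Lemma picked_succ (W : finType) (U : {set W}) (x : 'I_#|U| -> W) (i : 'I_#|U|) :
  picked x i.+1 = x i |: picked x i.
Proof.
apply/setP => w; rewrite in_setU1; apply/imsetP/orP => [[j]|[/eqP->|/imsetP[j]]].
- rewrite inE ltnS leq_eqVlt => /orP[/eqP/val_inj->|ltji] ->; first by left.
  by right; apply/imsetP; exists j; rewrite ?inE.
- by exists i; rewrite ?inE.
- by rewrite inE => ltji ->; exists j; rewrite ?inE ?ltnS 1?ltnW.
Qed.

Lemma picked0 (W : finType) (U : {set W}) (x : 'I_#|U| -> W) :
  picked x 0 = finset.set0.
Proof. by apply/setP => w; rewrite inE; apply/imsetP => -[j]; rewrite inE. Qed.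

(** A run must order all of [U], whereas the chain [S] only fixes the first [k] steps; after these,
    any maximiser will do. *)
Lemma greedy_run_extend (R : realType) (W : finType) (U : {set W})
    (f : {set W} -> R) (S : nat -> {set W}) (k : nat) :
  (0 < k)%N -> S 0%N = finset.set0 ->
  (forall i, (i < k)%N -> exists y, [/\ y \in U :\: S i, S i.+1 = y |: S i
     & forall z, z \in U :\: S i -> f (z |: S i) <= f (S i.+1)]) ->
  exists2 x : 'I_#|U| -> W, greedy_run f x
    & forall i, (i <= k)%N -> (i <= #|U|)%N -> picked x i = S i.
Proof.
move=> k0 S0 Sgreedy.
have [w0 _] := Sgreedy 0%N k0.
(* The pick depends on the current set [A] alone: [#|A|] is the step number, which reveals whether
   [A] is on the chain. When [A] is not a proper subset of [U], [w0] is a mere placeholder. *)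
have /choice[nxt nxtP] : forall A : {set W}, exists w, A \proper U ->
    [/\ w \in U :\: A, forall z, z \in U :\: A -> f (z |: A) <= f (w |: A)
      & (#|A| < k)%N -> A = S #|A| -> S #|A|.+1 = w |: A].
  move=> A; case: (pselect ((#|A| < k)%N /\ A = S #|A|)) => [[ltAk AS]|nAS].
    have [y [yA Sy ymax]] := Sgreedy _ ltAk; rewrite -AS in yA Sy ymax.
    by exists y => _; split=> // z /ymax; rewrite Sy.
  case: (boolP (A \proper U)) => [/properP[_ [y yU yA]]|_]; last by exists w0.
  have yUA : y \in U :\: A by rewrite inE yA.
  case: (arg_maxP (fun z => f (z |: A)) yUA) => w wUA wmax.
  by exists w => _; split=> // ltAk AS; case: nAS.
pose it i := iter i (fun A => nxt A |: A) finset.set0.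
pose x (i : 'I_#|U|) := nxt (it i).
have it_spec i : (i <= #|U|)%N ->
    [/\ it i \subset U, #|it i| = i & (i <= k)%N -> it i = S i].
  elim: i => [|i IHi] ltiU; first by rewrite /it /= finset.sub0set cards0 S0.
  have [itU itc itS] := IHi (ltnW ltiU).
  have itp : it i \proper U by rewrite properEcard itU itc.
  have [/setDP[nU nA] _ nS] := nxtP _ itp.
  rewrite /it iterS -/(it i); split=> [||ltik].
  - by rewrite finset.subUset finset.sub1set nU.
  - by rewrite cardsU1 nA itc.
  - by rewrite itc in nS; rewrite -nS// itS// ltnW.
have pickedE i : (i <= #|U|)%N -> picked x i = it i.
  elim: i => [|i IHi] ltiU; first by rewrite picked0.
  by rewrite (picked_succ x (Ordinal ltiU)) /= IHi // ltnW.
exists x => [i|i leik leiU]; last first.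
  by rewrite pickedE//; have [_ _ ->] := it_spec _ leiU.
have [itU itc _] := it_spec i (ltnW (ltn_ord i)).
rewrite pickedE 1?ltnW//.
have itp : it i \proper U by rewrite properEcard itU itc ltn_ord.
by have [nU nmax _] := nxtP _ itp.
Qed.

(** * Sums over vertices *)

Lemma sumr_option (R : nmodType) (I : finType) (F : option I -> R) :
  \sum_u F u = F None + \sum_i F (Some i).
Proof.
rewrite (bigD1 None)//=; congr (_ + _).
by rewrite (reindex_omap Some id) => [|[]]//=; apply: eq_bigl => i; rewrite eqxx.
Qed.

(** The instance has all pairs as edges, absent ones having capacity 0, so excesses become plain
    sums over vertices. *)
Lemma excess_setT (R : realType) (V : finType) (theta : V * V -> R) (v : V) :
  excess [set: V * V]%SET theta v =
  \sum_u theta (u, v) - \sum_u theta (v, u).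
Proof.
congr (_ - _).
- transitivity (\sum_(u : V) \sum_(w | w == v) theta (u, w)); last first.
    by apply: eq_bigr => u _; rewrite big_pred1_eq.
  by rewrite pair_big; apply: eq_big => [[u w]|[u w] _]//; rewrite !inE andbT.
- transitivity (\sum_(w | w == v) \sum_(u : V) theta (w, u)); last first.
    by rewrite big_pred1_eq.
  by rewrite pair_big; apply: eq_big => [[u w]|[u w] _]//; rewrite !inE !andbT.
Qed.

(** * The instance with blocks of size [m] *)

Section Instance.
Variables (R : realType) (n m : nat).
Hypothesis m0 : (0 < m)%N.

Local Notation k := (n.+1 * m)%N.
Local Notation V := (option ('I_n.+1 * 'I_m + 'I_k)).
Local Notation optv j := (Some (inl j) : V).
Local Notation grv l := (Some (inr l) : V).
Local Notation sinks := ([set~ None]%SET : {set V}).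
Local Notation edges := ([set: V * V]%SET).
Let q : R := 1 - m%:R^-1.

(* [None] is the source, [Some (inl (c, _))] are the optimal sinks of block [c]
   and [Some (inr l)] is the greedy sink g_l. *)
Definition capacity (c : 'I_n.+1) (e : V * V) : R :=
  match e with
  | (None, Some (inl _)) => 1
  | (Some (inl j), Some (inr l)) => if j.1 == c then q ^+ l / m%:R else 0
  | _ => 0
  end.

Let greedy_set (i : nat) : {set V} := [set grv l | l : 'I_k & (l < i)%N]%SET.

Let mR0 : 0 < m%:R :> R. Proof. by rewrite ltr0n. Qed.

Let q_ge0 : 0 <= q.
Proof. by rewrite subr_ge0 invf_le1// ler1n. Qed.

Let q_le1 : q <= 1.
Proof. by rewrite gerBl invr_ge0 ltW. Qed.

Let sum_q i : \sum_(l < i) q ^+ l = m%:R * (1 - q ^+ i).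
Proof.
have := subrX1 q i; rewrite [X in X * _](_ : _ = - m%:R^-1); last first.
  by rewrite /q addrAC subrr add0r.
move=> /(congr1 (fun z => - m%:R * z)); rewrite mulNr mulrA mulrNN divff ?gt_eqF//.
by rewrite mul1r -mulrN opprB => ->.
Qed.

Let capacity_ge0 c e : 0 <= capacity c e.
Proof.
by case: e => -[[j|l]|] [[j'|l']|]//=; rewrite ?ler01//; case: ifP => // _;
  rewrite mulr_ge0 ?exprn_ge0 ?invr_ge0 ?ler0n.
Qed.

Let sum_vertices (F : V -> R) :
  \sum_u F u = F None + (\sum_j F (optv j) + \sum_l F (grv l)).
Proof. by rewrite sumr_option big_sumType. Qed.

Let sum_capacity c l : \sum_j capacity c (optv j, grv l) = q ^+ l.
Proof.
rewrite /= -(pair_bigA _ (fun (j1 : 'I_n.+1) (_ : 'I_m) =>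
  if j1 == c then q ^+ l / m%:R else 0)) /=.
rewrite (bigD1 c)//= eqxx sumr_const card_ord big1 ?addr0; last first.
  by move=> j /negPf->; rewrite big1.
by rewrite -[LHS]mulr_natr divfK ?gt_eqF.
Qed.


(** * Bounds on the excess within one commodity *)

Section Excess.
Variables (c : 'I_n.+1) (theta : V * V -> R).
Hypothesis bnd : forall e, 0 <= theta e <= capacity c e.

Let theta_eq0 e : capacity c e = 0 -> theta e = 0.
Proof. by move=> e0; apply/eqP; rewrite eq_le andbC -{2}e0. Qed.

Lemma excess_optv j : excess edges theta (optv j) =
  theta (None, optv j) - \sum_l theta (optv j, grv l).
Proof.
rewrite excess_setT; congr (_ - _).
  by rewrite sum_vertices !big1 ?addr0// => ? _; exact: theta_eq0.
rewrite sum_vertices theta_eq0// [X in _ + (X + _)]big1 ?add0r// => ? _.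
exact: theta_eq0.
Qed.

Lemma excess_grv l :
  excess edges theta (grv l) = \sum_j theta (optv j, grv l).
Proof.
rewrite excess_setT [X in _ - X]big1 ?subr0; last first.
  by move=> [[?|?]|] _; exact: theta_eq0.
rewrite sum_vertices theta_eq0// [X in _ + (_ + X)]big1 ?addr0 ?add0r// => ? _.
exact: theta_eq0.
Qed.

Lemma excess_grv_le l : excess edges theta (grv l) <= q ^+ l.
Proof.
rewrite excess_grv -(sum_capacity c); apply: ler_sum => j _.
by have /andP[] := bnd (optv j, grv l).
Qed.

(** Flow from [j] to g_l lowers one excess and raises the other, so it cancels. What remains is at
    most 1 from the source and, into each g_l, the supply of the other m - 1 sinks of the block: (m
    - 1) q^l / m = q^(l+1). *)
Lemma excess_optv_greedy_le i j : j.1 = c ->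
  excess edges theta (optv j) +
    \sum_(l < k | (l < i)%N) excess edges theta (grv l)
  <= 1 + \sum_(l < k | (l < i)%N) q ^+ l.+1.
Proof.
move=> jc; rewrite excess_optv -addrA lerD//.
  by have /andP[_] := bnd (None, optv j).
rewrite addrC lerBlDr [X in _ <= _ + X](bigID (fun l : 'I_k => (l < i)%N)) /= addrA -big_split /=.
(* Flow from [j] to the g_l with l >= i only lowers the left side, so it is dropped. *)
rewrite -[leLHS]addr0; apply: lerD; last first.
  by apply: sumr_ge0 => l _; have /andP[] := bnd (optv j, grv l).
apply: ler_sum => l _; rewrite excess_grv (bigD1 j)//= addrC lerD2r.
rewrite (_ : q ^+ l.+1 = \sum_(j' | j' != j) capacity c (optv j', grv l)).
  by apply: ler_sum => j' _; have /andP[_] := bnd (optv j', grv l).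
have := sum_capacity c l; rewrite (bigD1 j)//= jc eqxx => sumc.
apply: (addrI (q ^+ l / m%:R)); rewrite sumc exprSr -mulrDr.
by rewrite (_ : _ + q = 1) ?mulr1// /q addrC subrK.
Qed.

End Excess.

(** * Two explicit multicommodity-flows: the saturating one and the direct one *)

Let capacity_bnd c e : 0 <= capacity c e <= capacity c e.
Proof. by rewrite capacity_ge0 lexx. Qed.

Let capacity_excess_grv c l : excess edges (capacity c) (grv l) = q ^+ l.
Proof. by rewrite (excess_grv (capacity_bnd c)) sum_capacity. Qed.

(** In commodity [c], an optimal sink of block [c] receives 1 and sends (1 + q + ... + q^(k-1)) / m
    = 1 - q^k <= 1; one of another block sends nothing. *)
Let capacity_flow : is_multiflow edges None sinks capacity capacity.
Proof.
move=> c; split=> [e _|v|v]; [exact: capacity_bnd|by rewrite !inE; case: eqP|].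
case: v => [[j|l]|]; rewrite !inE// => _; last first.
  by rewrite capacity_excess_grv exprn_ge0.
rewrite (excess_optv (capacity_bnd c)) /= subr_ge0; case: eqP => _; last first.
  by rewrite big1.
rewrite -mulr_suml sum_q mulrAC divff ?gt_eqF// mul1r.
by rewrite gerBl exprn_ge0.
Qed.

Definition direct_flow (c : 'I_n.+1) (e : V * V) : R :=
  if e is (None, Some (inl _)) then 1 else 0.

Let direct_bnd c e : 0 <= direct_flow c e <= capacity c e.
Proof.
have := capacity_ge0 c e.
by case: e => -[[j|l]|] [[j'|l']|] //= ->; rewrite ?ler01 ?lexx.
Qed.

Let direct_excess_optv c j : excess edges (direct_flow c) (optv j) = 1.
Proof. by rewrite (excess_optv (direct_bnd c)) /= big1 ?subr0. Qed.

Let direct_is_flow : is_multiflow edges None sinks capacity direct_flow.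
Proof.
move=> c; split=> [e _|v|v]; [exact: direct_bnd|by rewrite !inE; case: eqP|].
case: v => [[j|l]|]; rewrite !inE// => _; first by rewrite direct_excess_optv.
by rewrite (excess_grv (direct_bnd c)) big1.
Qed.

Let greedy_set_succ i (ltik : (i < k)%N) :
  greedy_set i.+1 = grv (Ordinal ltik) |: greedy_set i.
Proof.
apply/setP => w; rewrite in_setU1.
apply/imsetP/orP => [[l]|[/eqP->|/imsetP[l]]].
- rewrite inE ltnS leq_eqVlt => /orP[/eqP li|ltli] ->.
    by left; apply/eqP; congr (grv _); exact: val_inj.
  by right; apply/imsetP; exists l; rewrite ?inE.
- by exists (Ordinal ltik); rewrite ?inE.
- by rewrite inE => ltli ->; exists l; rewrite ?inE ?ltnS 1?ltnW.
Qed.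

Let sum_greedy_set i (F : V -> R) :
  \sum_(t in greedy_set i) F t = \sum_(l < k | (l < i)%N) F (grv l).
Proof.
rewrite big_imset /=; last by move=> l l' _ _ [].
by apply: eq_bigl => l; rewrite inE.
Qed.

Let sum_ltn_k i (F : nat -> R) : (i <= k)%N ->
  \sum_(l < k | (l < i)%N) F l = \sum_(l < i) F l.
Proof. by move=> leik; rewrite [RHS](big_ord_widen _ _ leik). Qed.

(** * Values of the objective and the greedy run *)

Section Objective.
Variable f : {set V} -> R.
Hypothesis fP : is_objective edges None sinks capacity f.

Let le_objective theta (X : {set V}) : X \subset sinks ->
  is_multiflow edges None sinks capacity theta -> minex_set edges theta X <= f X.
Proof. by move=> /fP[_ fub] flow; apply: fub; exists theta. Qed.

(** Since [minex] is below the excess in each commodity, an upper bound in a single well-chosen [c]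
    suffices. *)
Let objective_le (X : {set V}) c a : X \subset sinks ->
  (forall theta : V * V -> R, (forall e, 0 <= theta e <= capacity c e) ->
     \sum_(t in X) excess edges theta t <= a) ->
  f X <= a.
Proof.
move=> /fP[[theta flow <-] _] le_a; apply: le_trans (le_a (theta c) _).
  by apply: ler_sum => t _; exact: minex_le.
by move=> e; have [+ _ _] := flow c; apply; rewrite inE.
Qed.

Let greedy_set_sub i : greedy_set i \subset sinks.
Proof. by apply/fintype.subsetP => _ /imsetP[l _ ->]; rewrite !inE. Qed.

(** Every commodity can bring at most q^l into g_l, and the saturating flow brings exactly that in
    all of them at once. *)
Let objective_greedy_set i : (i <= k)%N -> f (greedy_set i) = \sum_(l < i) q ^+ l.
Proof.
move=> leik; rewrite -(sum_ltn_k (fun l => q ^+ l))//; apply/eqP; rewrite eq_le.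
apply/andP; split.
  apply: (@objective_le _ ord0) => // theta bnd; rewrite sum_greedy_set.
  by apply: ler_sum => l _; exact: excess_grv_le.
apply: le_trans (le_objective (greedy_set_sub i) capacity_flow).
rewrite /minex_set sum_greedy_set; apply: ler_sum => l _.
by apply: le_minex => c; rewrite capacity_excess_grv.
Qed.

(* The bound for an optimal sink uses the commodity in which that sink competes
   with the greedy sinks, and 1 + q (1 + ... + q^(i-1)) = 1 + ... + q^i. *)
Let objective_greedy_step i z : (i < k)%N -> z \in sinks :\: greedy_set i ->
  f (z |: greedy_set i) <= f (greedy_set i.+1).
Proof.
move=> ltik /setDP[zT zi]; rewrite objective_greedy_set//.
have sub : z |: greedy_set i \subset sinks.
  by rewrite finset.subUset finset.sub1set zT greedy_set_sub.
case: z => [[j|l]|] in zT zi sub *; last by rewrite !inE in zT.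
  apply: (@objective_le _ j.1) => // theta bnd.
  rewrite big_setU1//= sum_greedy_set big_ord_recl expr0.
  rewrite -(sum_ltn_k (fun l => q ^+ l.+1)) ?(ltnW ltik)//.
  exact: excess_optv_greedy_le.
(* A further greedy sink has l >= i, hence excess at most q^l <= q^i, in any commodity. *)
apply: (@objective_le _ ord0) => // theta bnd.
rewrite big_setU1//= sum_greedy_set big_ord_recr /= addrC.
rewrite -(sum_ltn_k (fun l => q ^+ l)) ?(ltnW ltik)//.
rewrite lerD ?ler_sum// => [l' _|]; first exact: excess_grv_le.
apply: le_trans (excess_grv_le bnd l) _; apply: ler_wiXn2l => //.
by rewrite leqNgt; apply: contra zi => ltli; apply/imsetP; exists l; rewrite ?inE.
Qed.

Let card_sinks : (k <= #|sinks|)%N.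
Proof.
by rewrite cardsC1 card_option card_sum card_prod !card_ord /= leq_addr.
Qed.

Let objective_optimal_set : k%:R <= f (optimal_set sinks f k).
Proof.
pose O : {set V} := [set optv j | j in [set: 'I_n.+1 * 'I_m]]%SET.
have optv_inj : injective (fun j => optv j) by move=> j j' [].
have Osub : O \subset sinks.
  by apply/fintype.subsetP => _ /imsetP[j _ ->]; rewrite !inE.
have Ocard : #|O| = k.
  by rewrite card_imset// cardsT card_prod !card_ord.
apply: (@le_trans _ _ (f O)).
  apply: le_trans (le_objective Osub direct_is_flow).
  rewrite /minex_set -[leLHS](congr1 (GRing.natmul 1) Ocard) -sum1_card natr_sum.
  apply: ler_sum => _ /imsetP[j _ ->].
  by apply: le_minex => c; rewrite direct_excess_optv.
rewrite /optimal_set; case: arg_maxP => [|X _].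
  by rewrite finset.sub0set cards0.
by apply; rewrite Osub Ocard leqnn.
Qed.

(** Only the term of index [k] in the maximum is used: k / (m (1 - q^k)), where k / m is the number
    of commodities. *)
Lemma greedy_run_ratio_ge :
  exists2 x : 'I_#|sinks| -> V, greedy_run f x
    & ((n.+1%:R / (1 - q ^+ k))%:E <= run_ratio f x)%E.
Proof.
have k0 : (0 < k)%N by rewrite muln_gt0.
have S0 : greedy_set 0 = finset.set0.
  by apply/setP => w; rewrite inE; apply/imsetP => -[l]; rewrite inE.
have [i ltik|x xgreedy xS] := greedy_run_extend k0 S0 (U := sinks) (f := f).
  exists (grv (Ordinal ltik)); split; last by move=> z; exact: objective_greedy_step.
    rewrite !inE andbT; apply/imsetP => -[l]; rewrite inE => + [] li.
    by rewrite -li ltnn.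
  exact: greedy_set_succ.
exists x => //.
have leks : (1 <= k < #|sinks|.+1)%N by rewrite k0 ltnS card_sinks.
rewrite /run_ratio.
apply: le_trans (@le_bigmax_seq _ _ _ _ _ k xpredT _ _ _) => //; last first.
  by rewrite mem_index_iota.
(* Positivity excludes the zero-denominator case of division in the extended reals. *)
have qk1 : 0 < 1 - q ^+ k.
  rewrite subr_gt0 exprn_ilt1// ?gt_eqF//.
  by rewrite gtrBl invr_gt0.
rewrite xS// objective_greedy_set// sum_q.
rewrite inver gt_eqF ?mulr_gt0// -EFinM lee_fin.
rewrite -(ler_pM2r qk1) divfK ?gt_eqF// invfM mulrA mulfVK ?gt_eqF//.
by rewrite ler_pdivlMr// -natrM.
Qed.

End Objective.

Lemma approximation_ratio_ge :
  ((n.+1%:R / (1 - (1 - m%:R^-1) ^+ k))%:E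
     <= approximation_ratio (@multi_sink_flow_objectives R n))%E.
Proof.
have [f fP] := @objective_exists R V edges None sinks n capacity
  (fun c e _ => capacity_ge0 c e).
have [x xgreedy /le_trans->//] := greedy_run_ratio_ge fP.
apply: ereal_sup_ubound; exists V, sinks, f, x; split=> //.
by exists edges, None, capacity; split.
Qed.

End Instance.

(** * Passage to large block sizes m = p + 2 *)

Lemma expRN_one_subV_le (R : realType) (p : nat) :
  expR (- p.+1%:R^-1) <= 1 - p.+2%:R^-1 :> R.
Proof.
(* As 1 - 1/m is the inverse of 1 + 1/(m - 1), this is 1 + x <= e^x inverted, at x = 1/(p + 1). *)
rewrite expRN (_ : 1 - _ = (1 + p.+1%:R^-1)^-1).
  by rewrite lef_pV2 ?posrE ?expR_gt0 ?addr_gt0 ?invr_gt0 ?ltr0n// expR_ge1Dx.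
rewrite -[p.+2]addn1 natrD; have : 0 < p.+1%:R :> R by [].
by move: p.+1%:R => x x0; field; rewrite !gt_eqF ?addr_gt0.
Qed.

(** An explicit error term instead of a limit: a (p + 2) / (p + 1) = a + a / (p + 1), and e^(-x) >=
    1 - x handles the second summand. *)
Lemma pow_one_subV_ge (R : realType) (a p : nat) :
  expR (- a%:R) * (1 - a%:R / p.+1%:R) <= (1 - p.+2%:R^-1) ^+ (a * p.+2) :> R.
Proof.
apply: (@le_trans _ _ (expR (- p.+1%:R^-1) ^+ (a * p.+2))); last first.
  by rewrite lerXn2r ?nnegrE ?expR_ge0 ?expRN_one_subV_le//
    (le_trans (expR_ge0 _) (expRN_one_subV_le R p)).
rewrite -expRM_natl.
rewrite [X in _ <= expR X](_ : _ = - a%:R + - (a%:R / p.+1%:R)); last first.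
  have p1 : p.+1%:R != 0 :> R by rewrite pnatr_eq0.
  rewrite natrM -[p.+2]addn1 natrD mulrN mulrDr mulr1 mulrDl.
  by rewrite -mulrA divff// mulr1 opprD.
by rewrite expRD ler_wpM2l ?expR_ge0// expR_ge1Dx.
Qed.

Theorem theorem13 (R : realType) (n : nat) :
  ((n.+1%:R * (expR n.+1%:R / (expR n.+1%:R - 1)))%:E
     <= approximation_ratio (@multi_sink_flow_objectives R n))%E.
Proof.
set a : R := n.+1%:R; set E := expR (- a).
have a0 : 0 < a by rewrite ltr0n.
have E0 : 0 < E by exact: expR_gt0.
have E1 : 0 < 1 - E by rewrite subr_gt0 expR_lt1 oppr_lt0.
have -> : a * (expR a / (expR a - 1)) = a / (1 - E).
  rewrite /E expRN; have : 1 < expR a by rewrite expR_gt1.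
  by move: (expR a) => x x1; field; rewrite !gt_eqF ?subr_gt0 ?(lt_trans ltr01).
have ge_ratio p : ((a / (1 - (1 - p.+2%:R^-1) ^+ (n.+1 * p.+2)))%:E <=
    approximation_ratio (@multi_sink_flow_objectives R n))%E.
  exact: approximation_ratio_ge.
(* The bound is trivial for a ratio +oo, and the instance with p = 0 excludes -oo. *)
case: (approximation_ratio _) ge_ratio => [r||] ge_ratio; last 2 first.
- by rewrite leey.
- by have := ge_ratio 0%N.
rewrite lee_fin ler_pdivrMr//.
have r_ge p : a <= r * (1 - E) + r * E * a / p.+1%:R.
  have := ge_ratio p; rewrite lee_fin.
  have q_lt1 : (1 - p.+2%:R^-1) ^+ (n.+1 * p.+2) < 1 :> R.
    rewrite exprn_ilt1 ?gtrBl ?invr_gt0//.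
    by rewrite subr_ge0 invf_le1 ?ler1n.
  rewrite ler_pdivrMr ?subr_gt0// => a_le; apply: (le_trans a_le).
  (* The sign of [r] is needed to multiply the lower bound on the power by [r]. *)
  have r0 : 0 < r.
    rewrite -subr_gt0 in q_lt1.
    by rewrite -(pmulr_lgt0 r q_lt1) (lt_le_trans a0).
  rewrite -!mulrA -mulrDr ler_pM2l// -addrA lerD2l lerNl opprD opprK.
  by have := @pow_one_subV_ge R n.+1 p; rewrite mulrBr mulr1.
(* If a - r (1 - E) were some d > 0, a large [p] would push the error term r E a / (p + 1) below d,
   against [r_ge]. *)
rewrite leNgt; apply/negP; rewrite -subr_gt0; set d := _ - _ => d0.
have [p pd] : exists p : nat, r * E * a / d < p.+1%:R.
  by exists (Num.truncn (r * E * a / d)); exact: truncnS_gt.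
have := r_ge p; rewrite -lerBlDl -/d leNgt ltr_pdivrMr ?ltr0n//.
by rewrite [d * _]mulrC -ltr_pdivrMr// pd.
Qed.
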